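(* Let $(\Omega,\Sigma,\mu)$ be a positive measure space with $\mu(\Omega)<\infty$ and let $\mathcal{F}\subseteq B_\mu(\Omega;\mathbb{R})$ be an arbitrary subclass of $\mu$-measurable functions. Then $$\kappa^{+}_{n+1}(\mathcal{F};\mu)\le 2\,\mu(\Omega)\,d_n(\mathcal{F})_{B_\mu(\Omega)}\quad\text{for all } n\in\mathbb{N}_0=\{0,1,2,\ldots\}.$$
   Context: $B_\mu(\Omega;\mathbb{R})$ is the space of all bounded $\mu$-measurable functions $f:\Omega\to\mathbb{R}$ (proper functions, not equivalence classes) with norm $\|f\|_\infty:=\sup_{x\in\Omega}|f(x)|$. The Tchakaloff quadrature widths are, for $n\in\mathbb{N}$, $$\kappa^{+}_n(\mathcal{F};\mu):=\inf_{\substack{x_1,\ldots,x_n\in\Omega\\ \mu_1,\ldots,\mu_n\ge0}}\ \sup_{f\in\mathcal{F}}\Big|\int_\Omega f(x)\,\mathrm{d}\mu(x)-\sum_{j=1}^n\mu_jf(x_j)\Big|.$$ The Kolmogorov widths are, for $n\ge1$, $$d_n(\mathcal{F})_{B_\mu(\Omega)}:=\inf_{\varphi_1,\ldots,\varphi_n\in B_\mu(\Omega;\mathbb{R})}\ \sup_{f\in\mathcal{F}}\ \inf_{c_1,\ldots,c_n\in\mathbb{R}}\Big\|f-\sum_{j=1}^nc_j\varphi_j\Big\|_\infty,$$ and $d_0(\mathcal{F})_{B_\mu(\Omega)}:=\sup_{f\in\mathcal{F}}\|f\|_\infty$. *)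

(* Defs.v *)
From HB Require Import structures.
From mathcomp Require Import all_boot all_order all_algebra.
From mathcomp Require Import all_classical all_reals all_analysis.
Set Implicit Arguments.
Unset Strict Implicit.
Unset Printing Implicit Defensive.
Import Order.TTheory GRing.Theory Num.Theory.
Import numFieldNormedType.Exports.
Local Open Scope classical_set_scope.
Local Open Scope ring_scope.
Local Open Scope ereal_scope.

Definition bounded_measurable (d : measure_display) (T : measurableType d)
    (R : realType) : set (T -> R) :=
  [set f : T -> R | measurable_fun [set: T] f /\ bounded_fun f].

Definition sup_norm (T : Type) (R : realType) (f : T -> R) : \bar R :=
  ereal_sup [set `|f x|%:E | x in [set: T]].

(* All suprema and infima are taken in [\bar R], so a width may be [+oo];
   over the empty class of functions a supremum is [-oo]. *)
Definition tchakaloff_width (d : measure_display) (T : measurableType d)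
    (R : realType) (mu : {measure set T -> \bar R}) (F : set (T -> R))
    (n : nat) : \bar R :=
  ereal_inf [set
    ereal_sup [set
      `| \int[mu]_x (f x)%:E - (\sum_(j < n) p.2 j * f (p.1 j))%R%:E |
      | f in F]
    | p in [set p : ('I_n -> T) * ('I_n -> R) |
             forall j, (0 <= p.2 j)%R]].

Definition kolmogorov_width (d : measure_display) (T : measurableType d)
    (R : realType) (F : set (T -> R)) (n : nat) : \bar R :=
  if n is 0%N then ereal_sup [set sup_norm f | f in F]
  else ereal_inf [set
    ereal_sup [set
      ereal_inf [set
        sup_norm (fun x => f x - \sum_(j < n) c j * phi j x)%R
        | c in [set: 'I_n -> R]]
      | f in F]
    | phi in [set phi : 'I_n -> T -> R |
               forall j, bounded_measurable (phi j)]].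

(* Main.v *)
Require Import Defs.
From HB Require Import structures.
From mathcomp Require Import all_boot all_order all_algebra.
From mathcomp Require Import all_classical all_reals all_analysis.
From mathcomp Require Import measurable_realfun lra ring.
Set Implicit Arguments.
Unset Strict Implicit.
Unset Printing Implicit Defensive.
Import Order.TTheory GRing.Theory Num.Theory.
Import numFieldNormedType.Exports.
Local Open Scope classical_set_scope.
Local Open Scope ring_scope.

(** The bound comes from Tchakaloff's theorem ([Tchakaloff]): if [mu] is finite
    and [phi_1, ..., phi_n] are integrable, some quadrature with [n + 1] nodes
    and nonnegative weights integrates [1, phi_1, ..., phi_n] exactly.  Let [h]
    be any linear combination of the [phi_i].  The quadrature error at [f] is
    its error at [f - h], and both the integral and the weighted sum of [f - h]
    are at most [mu(Omega) * ||f - h||_oo] in absolute value, because the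
    weights add up to [mu(Omega)].  This is where the factor 2 comes from
    ([quadrature_error]).  The quadrature depends neither on [f] nor on the
    coefficients of [h], so one may take the infimum over [h], then the
    supremum over [f], and finally the infimum over the [phi_i]
    ([tchakaloff_width_le]).  Exactness is essential: the coefficients of [h]
    are unbounded, so a quadrature that is merely accurate on each [phi_i]
    would not do.

    Tchakaloff's theorem combines two facts about a vector-valued function
    [phi : Omega -> R^m], applied to [phi = (1, phi_1, ..., phi_n)].

    - The integral of [phi] lies in the convex cone generated by the values of
      [phi], not merely in the closure of that cone ([integral_in_cone_hull]).
      Otherwise a nonzero linear form [l] is nonnegative on the cone and
      nonpositive at the integral.  Then [l o phi] is nonnegative with integral
      zero, so it vanishes almost everywhere; restricting the domain to its
      zero set puts all values of [phi] in a hyperplane without changing the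
      integral, and induction on [m] applies.  Since the cone need not be
      closed, the separation theorem used here is the one for arbitrary convex
      sets ([convex_sep]).
    - An element of a cone generated in [R^m] is a combination of [m]
      generators (Caratheodory, [cone_Caratheodory]). *)

(** * Separation of a point from a convex set *)

(** Induction on the dimension, by a one-step Hahn-Banach extension.  If the
    first coordinate has a constant sign on [C], it is (up to sign) the form
    sought.  Otherwise the slice of [C] by the hyperplane where the first
    coordinate vanishes is a nonempty convex set in one dimension less,
    separated from [0] by some [l]; it remains to choose a coefficient [t] for
    the first coordinate.  Each point on the positive side bounds [t] from
    below, each point on the negative side bounds it from above, and these
    bounds are compatible because the segment joining two such points meets
    the slice. *)
Lemma convex_sep (R : realType) (m : nat) (C : set 'rV[R]_m) :
    C !=set0 -> ~ C 0 ->
    (forall u v a b, C u -> C v -> 0 < a -> 0 < b -> a + b = 1 ->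
       C (a *: u + b *: v)) ->
  exists2 l : 'cV[R]_m, l != 0 & forall v, C v -> 0 <= (v *m l) 0 0.
Proof.
elim: m C => [|m IHm] C.
  by move=> [v Cv] C0; case: C0; rewrite -(thinmx0 v).
move: C; rewrite -[m.+1]/(1 + m)%N => C [v0 Cv0] C0 convC.
have split_dot (v : 'rV[R]_(1 + m)) t (l : 'cV[R]_m) :
    (v *m col_mx t%:M l) 0 0 = v 0 0 * t + (rsubmx v *m l) 0 0.
  rewrite -{1}(hsubmxK v) mul_row_col mul_mx_scalar !mxE mulrC.
  by congr (v _ _ * _ + _); apply/val_inj.
have one_side t : t != 0 -> (forall v, C v -> 0 <= v 0 0 * t) ->
    exists2 l : 'cV[R]_(1 + m), l != 0 & forall v, C v -> 0 <= (v *m l) 0 0.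
  move=> t0 Ct; exists (col_mx t%:M 0).
    rewrite col_mx_eq0 negb_and; apply/orP; left; apply/eqP => /matrixP/(_ 0 0).
    by rewrite !mxE/= => /eqP; rewrite mulr1n (negbTE t0).
  by move=> v /Ct; rewrite split_dot mulmx0 mxE addr0.
have [[x Cx x0]|nopos] := pselect (exists2 x, C x & 0 < x 0 0); last first.
  apply: (one_side (-1)); first by rewrite oppr_eq0 oner_eq0.
  move=> v Cv; rewrite mulrN1 oppr_ge0 leNgt; apply/negP => v_gt0.
  by apply: nopos; exists v.
have [[y Cy y0]|noneg] := pselect (exists2 y, C y & y 0 0 < 0); last first.
  apply: (one_side 1); first by rewrite oner_eq0.
  move=> v Cv; rewrite mulr1 leNgt; apply/negP => v_lt0.
  by apply: noneg; exists v.
pose C' : set 'rV[R]_m := [set w | C (row_mx 0 w)].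
(* The point of the segment from u to v whose first coordinate is zero. *)
have slice u v : C u -> C v -> 0 < u 0 0 -> v 0 0 < 0 ->
    C' ((u 0 0 - v 0 0)^-1 *: (u 0 0 *: rsubmx v - v 0 0 *: rsubmx u)).
  move=> Cu Cv u0 v0'.
  have uv0 : 0 < u 0 0 - v 0 0 by rewrite subr_gt0 (lt_trans v0').
  have := convC u v (- v 0 0 / (u 0 0 - v 0 0)) (u 0 0 / (u 0 0 - v 0 0)) Cu Cv.
  rewrite !divr_gt0 ?oppr_gt0// -mulrDl (addrC (- _)) divff ?gt_eqF//.
  move=> /(_ isT isT erefl); rewrite /C'/=; congr C.
  apply/rowP => j; rewrite -[j]splitK; case: (fintype.split j) => k /=.
    rewrite row_mxEl !mxE ord1.
    have -> : lshift m (0 : 'I_1) = 0 by apply/val_inj.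
    by field; rewrite gt_eqF.
  by rewrite row_mxEr !mxE; field; rewrite gt_eqF.
have [|||l l0 Hl] := IHm C'.
- by eexists; exact: (slice x y).
- by rewrite /C'/= row_mx0.
- move=> u v a b Cu Cv a0 b0 ab; rewrite /C'/=.
  have := convC _ _ a b Cu Cv a0 b0 ab.
  by rewrite !scale_row_mx add_row_mx !scaler0 addr0.
(* Every lower bound on the coefficient of the first coordinate is at most
   every upper bound. *)
have sign u v : C u -> C v -> 0 < u 0 0 -> v 0 0 < 0 ->
    - (rsubmx u *m l) 0 0 / u 0 0 <= - (rsubmx v *m l) 0 0 / v 0 0.
  move=> Cu Cv u0 v0'; have := Hl _ (slice u v Cu Cv u0 v0').
  rewrite -scalemxAl mxE pmulr_rge0 ?invr_gt0 ?subr_gt0 ?(lt_trans v0')//.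
  rewrite mulmxBl -!scalemxAl.
  rewrite [X in 0 <= X]mxE [X in _ + X]mxE [X in X - _]mxE [X in _ - X]mxE.
  set p := (rsubmx u *m l) 0 0; set q := (rsubmx v *m l) 0 0 => H.
  rewrite ler_pdivrMr// mulrAC ler_ndivlMr//.
  by nra.
pose S : set R :=
  [set - (rsubmx u *m l) 0 0 / u 0 0 | u in [set u | C u /\ 0 < u 0 0]].
have S0 : S !=set0 by exists (- (rsubmx x *m l) 0 0 / x 0 0); exists x.
exists (col_mx (sup S)%:M l); first by rewrite col_mx_eq0 negb_and l0 orbT.
move=> v Cv; rewrite split_dot; have [vlt|vgt|v00] := ltgtP (v 0 0) 0.
- have : sup S <= - (rsubmx v *m l) 0 0 / v 0 0.
    by apply: ge_sup => // _ [u [Cu u0] <-]; exact: sign.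
  by rewrite ler_ndivlMr// mulrC; lra.
- have : - (rsubmx v *m l) 0 0 / v 0 0 <= sup S.
    apply: ub_le_sup; last by exists v.
    by exists (- (rsubmx y *m l) 0 0 / y 0 0) => _ [u [Cu u0] <-]; exact: sign.
  by rewrite ler_pdivrMr// mulrC; lra.
- rewrite v00 mul0r add0r; apply: Hl; rewrite /C'/=.
  suff <- : lsubmx v = 0 by rewrite hsubmxK.
  apply/rowP => j; rewrite !mxE ord1 -v00; congr (v _ _); exact/val_inj.
Qed.

(** * Finitely generated conic combinations *)

(** The convex cone generated by the values of [phi] on [D].  Adding one
    generator at a time lets Caratheodory's theorem be proved by induction on
    the combination, with a single reduction step per generator. *)
Inductive cone_hull (R : numDomainType) (T : Type) (m : nat) (D : set T)
    (phi : T -> 'rV[R]_m) : 'rV[R]_m -> Prop :=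
  | cone_hull0 : cone_hull D phi 0
  | cone_hull_cons (w : R) (x : T) (v : 'rV[R]_m) :
      0 <= w -> D x -> cone_hull D phi v ->
      cone_hull D phi (w *: phi x + v).

Section ConeHull.
Context {R : numDomainType} {T : Type} {m : nat} {D : set T}.
Context {phi : T -> 'rV[R]_m}.

Lemma cone_hullD u v :
  cone_hull D phi u -> cone_hull D phi v -> cone_hull D phi (u + v).
Proof.
elim=> [|w x u' w0 Dx _ IH] hv; first by rewrite add0r.
by rewrite -addrA; apply: cone_hull_cons => //; exact: IH.
Qed.

Lemma cone_hullZ a v :
  0 <= a -> cone_hull D phi v -> cone_hull D phi (a *: v).
Proof.
move=> a0; elim=> [|w x u' w0 Dx _ IH].
  by rewrite scaler0; exact: cone_hull0.
by rewrite scalerDr scalerA; apply: cone_hull_cons => //; exact: mulr_ge0.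
Qed.

Lemma cone_hullS (E : set T) v :
  E `<=` D -> cone_hull E phi v -> cone_hull D phi v.
Proof.
by move=> ED; elim=> [|w x u w0 /ED Dx _ hu]; [left|right].
Qed.

End ConeHull.

(** The reduction step of Caratheodory's theorem: [m + 1] vectors of [R^m]
    satisfy a linear relation [u] with a positive coefficient, and subtracting
    the largest multiple of [u] that keeps all the weights nonnegative makes
    one of them vanish. *)
Lemma cone_drop_term (R : realFieldType) (T : Type) (m : nat)
    (phi : T -> 'rV[R]_m) (w : 'I_m.+1 -> R) (x : 'I_m.+1 -> T) :
    (forall i, 0 <= w i) ->
  exists (w' : 'I_m -> R) (x' : 'I_m -> T), (forall i, 0 <= w' i) /\
    \sum_i w i *: phi (x i) = \sum_i w' i *: phi (x' i).
Proof.
move=> w0; pose A : 'M[R]_(m.+1, m) := \matrix_i phi (x i).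
have [u uA [i0 ui0]] :
    exists2 u : 'rV[R]_m.+1, u *m A = 0 & exists i, 0 < u 0 i.
  have : kermx A != 0.
    rewrite kermx_eq0 /row_free neq_ltn ltnS; apply/orP; left.
    exact: rank_leq_col.
  move=> /rowV0Pn[u /sub_kermxP uA u0].
  have [i ui] : exists i, u 0 i != 0.
    apply/existsP; rewrite -negb_forall; apply: contraNN u0 => /forallP u0.
    by apply/eqP/rowP => i; rewrite mxE; exact/eqP.
  have [ui_gt|ui_le] := ltP 0 (u 0 i); first by exists u => //; exists i.
  exists (- u); first by rewrite mulNmx uA oppr0.
  by exists i; rewrite mxE oppr_gt0 lt_neqAle ui.
have {uA} u_dep : \sum_i u 0 i *: phi (x i) = 0.
  by rewrite -[RHS]uA mulmx_sum_row; apply: eq_bigr => i _; rewrite rowK.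
case: (@arg_minP _ _ _ i0 (fun i => 0 < u 0 i) (fun i => w i / u 0 i) ui0).
(* The minimal ratio is the step at which the first weight, that of k, reaches
   zero. *)
move=> k uk kmin; pose theta := w k / u 0 k.
exists (fun i => w (lift k i) - theta * u 0 (lift k i)), (x \o lift k); split.
  move=> i; set j := lift k i; rewrite subr_ge0.
  have [uj|uj] := ltP 0 (u 0 j); first by rewrite -ler_pdivlMr//; exact: kmin.
  by rewrite (le_trans _ (w0 j))// mulr_ge0_le0// divr_ge0// ltW.
transitivity (\sum_i (w i - theta * u 0 i) *: phi (x i)).
  under [RHS]eq_bigr do rewrite scalerBl -scalerA.
  by rewrite sumrB -scaler_sumr u_dep scaler0 subr0.
by rewrite (bigD1_ord k)//= divfK ?gt_eqF// subrr scale0r add0r.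
Qed.

Lemma cone_Caratheodory (R : realFieldType) (T : pointedType) (m : nat)
    (D : set T) (phi : T -> 'rV[R]_m) (v : 'rV[R]_m) :
    cone_hull D phi v ->
  exists (w : 'I_m -> R) (x : 'I_m -> T), (forall i, 0 <= w i) /\
    v = \sum_i w i *: phi (x i).
Proof.
elim=> [|a y u a0 _ _ [w [x [w0 ->]]]].
  exists (fun=> 0), (fun=> point); split=> //.
  by rewrite big1// => i _; rewrite scale0r.
pose w1 i := oapp w a (unlift ord0 i); pose x1 i := oapp x y (unlift ord0 i).
have w1_ge0 i : 0 <= w1 i by rewrite /w1; case: unlift => [j|]/=.
have [w' [x' [w'0 e]]] := cone_drop_term phi x1 w1_ge0.
exists w', x'; split=> //; rewrite -e big_ord_recl /w1 /x1 unlift_none/=.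
by congr (_ + _); apply: eq_bigr => i _; rewrite liftK.
Qed.

(** Separating [0] from the convex set [cone - b] gives a form [l] with
    [l v >= l b] for [v] in the cone.  Taking [v = 0] gives [l b <= 0], and a
    value [l (phi x) < 0] is impossible since its positive multiples are
    unbounded below. *)
Lemma cone_sep (R : realType) (T : Type) (m : nat) (D : set T)
    (phi : T -> 'rV[R]_m) (b : 'rV[R]_m) :
    ~ cone_hull D phi b ->
  exists l : 'cV[R]_m, [/\ l != 0, (b *m l) 0 0 <= 0 &
    forall x, D x -> 0 <= (phi x *m l) 0 0].
Proof.
move=> hb; move: (@convex_sep R m [set v - b | v in cone_hull D phi]) => [|||l l0 Hl].
- by exists (0 - b); exists 0 => //; exact: cone_hull0.
- by move=> [v hv /eqP]; rewrite subr_eq0 => /eqP vb; apply: hb; rewrite -vb.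
- move=> _ _ s t [u hu <-] [v hv <-] s0 t0 st1.
  exists (s *: u + t *: v).
    by apply: cone_hullD; apply: cone_hullZ => //; exact: ltW.
  by rewrite !scalerBr addrACA -opprD -scalerDl st1 scale1r.
exists l; split=> //.
  by have := Hl (0 - b); rewrite sub0r mulNmx mxE oppr_ge0; apply; exists 0;
    [exact: cone_hull0|rewrite sub0r].
move=> x Dx; rewrite leNgt; apply/negP => neg.
set p := (phi x *m l) 0 0 in neg; set q := (b *m l) 0 0.
(* Chosen so that t * p = - (1 + |q|), which is less than q. *)
pose t := (1 + `|q|) / - p.
have t0 : 0 <= t by rewrite divr_ge0 ?addr_ge0// oppr_ge0 ltW.
have : 0 <= ((t *: phi x - b) *m l) 0 0.
  apply: Hl; exists (t *: phi x) => //; rewrite -[_ *: _]addr0.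
  by apply: cone_hull_cons => //; exact: cone_hull0.
rewrite mulmxBl -scalemxAl [X in 0 <= X]mxE [X in X + _]mxE [X in _ + X]mxE.
rewrite -/p -/q.
have -> : t * p = - (1 + `|q|) by rewrite /t; field; rewrite lt_eqF.
have := ler_norm (- q); rewrite normrN; lra.
Qed.

(** A vector of a hyperplane whose equation involves the [k]-th coordinate is
    determined by its other coordinates; this is what makes the hyperplane a
    space of dimension [m]. *)
Lemma eq_on_hyperplane (F : fieldType) (m : nat) (k : 'I_m.+1)
    (l : 'cV[F]_m.+1) (u v : 'rV[F]_m.+1) :
  l k 0 != 0 -> u *m l = v *m l -> col' k u = col' k v -> u = v.
Proof.
move=> lk /matrixP/(_ 0 0) uv /rowP cuv.
have eq_lift i : u 0 (lift k i) = v 0 (lift k i) by have := cuv i; rewrite !mxE.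
apply/rowP => j; case: (unliftP k j) => [i ->|->]; first exact: eq_lift.
move: uv; rewrite !mxE !(bigD1_ord k)//= => uv; apply: (mulIf lk).
move: uv; rewrite (eq_bigr (fun i => v 0 (lift k i) * l (lift k i) 0)).
  exact: addIr.
by move=> i _; rewrite eq_lift.
Qed.

(** The dimension drop: inside a hyperplane, membership in the cone can be
    tested after deleting a coordinate that the hyperplane determines. *)
Lemma cone_hull_hyperplane (F : numFieldType) (T : Type) (m : nat)
    (k : 'I_m.+1) (l : 'cV[F]_m.+1) (D : set T) (phi : T -> 'rV[F]_m.+1)
    (b : 'rV[F]_m.+1) :
    l k 0 != 0 -> (forall x, D x -> phi x *m l = 0) -> b *m l = 0 ->
  cone_hull D (col' k \o phi) (col' k b) -> cone_hull D phi b.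
Proof.
move=> lk phil bl hb.
have [v [hv vl vb]] : exists v, [/\ cone_hull D phi v, v *m l = 0 &
    col' k v = col' k b].
  elim: hb => [|w x u w0 Dx _ [v [hv vl vu]]].
    exists 0; split; [exact: cone_hull0|by rewrite mul0mx|].
    by apply/rowP => i; rewrite !mxE.
  exists (w *: phi x + v); split; first exact: cone_hull_cons.
    by rewrite mulmxDl -scalemxAl phil// vl scaler0 addr0.
  by rewrite -vu; apply/rowP => i; rewrite !mxE.
by rewrite -(eq_on_hyperplane lk _ vb)// vl bl.
Qed.

(** * The integral lies in the cone generated by the values *)

Section IntegralInCone.
Context {d : measure_display} {T : measurableType d} {R : realType}.
Variable mu : {measure set T -> \bar R}.

Lemma integrable_dot (m : nat) (D : set T) (phi : T -> 'rV[R]_m)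
    (l : 'cV[R]_m) :
    measurable D ->
    (forall i, mu.-integrable D (fun x => (phi x 0 i)%:E)) ->
  mu.-integrable D (fun x => ((phi x *m l) 0 0)%:E).
Proof.
move=> mD iphi; have -> : (fun x => ((phi x *m l) 0 0)%:E) =
    (fun x => \sum_i ((l i 0)%:E * (phi x 0 i)%:E)%E).
  apply/funext => x; rewrite mxE -sumEFin; apply: eq_bigr => i _.
  by rewrite -EFinM mulrC.
by apply: integrable_sum => // i _; exact: integrableZl.
Qed.

Lemma Rintegral_dot (m : nat) (D : set T) (phi : T -> 'rV[R]_m) (l : 'cV[R]_m) :
    measurable D ->
    (forall i, mu.-integrable D (fun x => (phi x 0 i)%:E)) ->
  \int[mu]_(x in D) (phi x *m l) 0 0 =
  ((\row_i \int[mu]_(x in D) phi x 0 i) *m l) 0 0.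
Proof.
move=> mD iphi; rewrite /Rintegral.
have -> : (fun x => ((phi x *m l) 0 0)%:E) =
    (fun x => \sum_i ((l i 0)%:E * (phi x 0 i)%:E)%E).
  apply/funext => x; rewrite mxE -sumEFin; apply: eq_bigr => i _.
  by rewrite -EFinM mulrC.
rewrite integral_sum//; last by move=> i; exact: integrableZl.
rewrite mxE; apply: EFin_inj.
rewrite -sumEFin fineK; last first.
  rewrite sum_fin_num; apply/allP => _ /mapP[i _ ->].
  by apply: integrable_fin_num => //; exact: integrableZl.
apply: eq_bigr => i _; rewrite integralZl// mxE EFinM fineK 1?muleC//.
exact: integrable_fin_num.
Qed.

Lemma measurable_zero_set (D : set T) (g : T -> R) :
    measurable D -> measurable_fun D g ->
  measurable (D `&` [set x | g x = 0]).
Proof.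
by move=> mD mg; exact: mg mD _ (measurable_set1 0).
Qed.

(** A nonnegative function of integral zero vanishes almost everywhere, so its
    zero set carries the whole integral of any other function. *)
Lemma Rintegral_zero_set (D : set T) (g f : T -> R) :
    measurable D -> mu.-integrable D (EFin \o g) ->
    mu.-integrable D (EFin \o f) ->
    (forall x, D x -> 0 <= g x) -> \int[mu]_(x in D) g x = 0 ->
  \int[mu]_(x in D `&` [set x | g x = 0]) f x = \int[mu]_(x in D) f x.
Proof.
move=> mD ig iF g0 int0; have mg := measurable_int mu ig.
have mZ : measurable (D `&` [set x | g x = 0]).
  by apply: measurable_zero_set => //; exact/measurable_EFinP.
have ae0 : ae_eq mu D (EFin \o g) (cst 0%E).
  apply/(ae_eq_integral_abs mu mD mg).
  rewrite -[RHS]/((0 : R)%:E) -int0 fineK; last exact: integrable_fin_num.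
  by apply: eq_integral => x /[!inE] Dx; rewrite /= ger0_norm// g0.
set Z := D `&` _ in mZ *; have DZ : D `&` Z = Z by rewrite /Z setIA setIid.
rewrite /Rintegral -[in LHS]DZ integral_mkcondr; congr fine.
apply: ae_eq_integral => //; first 2 last.
- apply: filterS ae0 => x /= gx Dx; rewrite patchE.
  by rewrite ifT// inE; split=> //; apply: EFin_inj; exact: gx.
- apply/measurable_restrict => //; rewrite DZ.
  exact: measurable_int (integrableS mD mZ (@subIsetl _ _ _) iF).
- exact: measurable_int iF.
Qed.

(** The domain [D] is part of the induction because it shrinks to the zero set
    of the separating form at each step. *)
Lemma integral_in_cone_hull (m : nat) (D : set T) (phi : T -> 'rV[R]_m) :
    measurable D -> (forall i, mu.-integrable D (fun x => (phi x 0 i)%:E)) ->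
  cone_hull D phi (\row_i \int[mu]_(x in D) phi x 0 i).
Proof.
elim: m D phi => [|m IHm] D phi mD iphi.
  by rewrite [X in cone_hull _ _ X]thinmx0; exact: cone_hull0.
set b := \row_i _; apply: contrapT => nb.
have [l [l0 bl phil]] := cone_sep nb.
pose g x := (phi x *m l) 0 0.
have ig : mu.-integrable D (EFin \o g) by exact: integrable_dot.
have gb : \int[mu]_(x in D) g x = (b *m l) 0 0 by exact: Rintegral_dot.
have g0 : \int[mu]_(x in D) g x = 0.
  by apply/eqP; rewrite eq_le {1}gb bl Rintegral_ge0.
have bl0 : b *m l = 0 by apply/rowP => j; rewrite ord1 -gb g0 mxE.
have [k lk] : exists k, l k 0 != 0.
  apply/existsP; rewrite -negb_forall; apply: contraNN l0 => /forallP l0.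
  by apply/eqP/colP => i; rewrite mxE; exact/eqP.
pose Z := D `&` [set x | g x = 0].
have mZ : measurable Z.
  by apply: measurable_zero_set => //; exact/measurable_EFinP/measurable_int/ig.
apply: nb; apply: cone_hullS (@subIsetl _ D _) _.
apply: (@cone_hull_hyperplane _ _ _ k l Z) => //.
  by move=> x [_ gx]; apply/rowP => j; rewrite ord1 [RHS]mxE; exact: gx.
have -> : col' k b = \row_i \int[mu]_(x in Z) (col' k \o phi) x 0 i.
  apply/rowP => i; rewrite !mxE -(@Rintegral_zero_set D g)//; last exact: iphi.
  by apply: eq_Rintegral => x _; rewrite /= mxE.
apply: IHm => // i; apply: (integrableS mD) => //; first exact: subIsetl.
by apply: eq_integrable (iphi (lift k i)) => // x _; rewrite /= mxE.
Qed.

End IntegralInCone.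

(** * Tchakaloff quadratures *)

Lemma finite_integrable_cst (d : measure_display) (T : measurableType d)
    (R : realType) (mu : {measure set T -> \bar R}) (r : R) :
  (mu [set: T] < +oo)%E -> mu.-integrable [set: T] (EFin \o cst r).
Proof.
move=> muoo; apply: measurable_bounded_integrable => //.
by exists `|r|; split=> // M rM x _ /=; exact: ltW.
Qed.

(** The cone of [R^(n+1)] generated by the values of [(1, phi_1, ..., phi_n)]
    contains the integral of this vector, whose coordinate at the constant [1]
    is [mu(Omega)]; hence [n + 1] nodes and weights of total mass
    [mu(Omega)]. *)
Lemma Tchakaloff (d : measure_display) (T : measurableType d) (R : realType)
    (mu : {measure set T -> \bar R}) (n : nat) (phi : 'I_n -> T -> R) :
    (mu [set: T] < +oo)%E ->
    (forall i, mu.-integrable [set: T] (EFin \o phi i)) ->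
  exists (x : 'I_n.+1 -> T) (w : 'I_n.+1 -> R),
    [/\ forall j, 0 <= w j, \sum_j w j = fine (mu [set: T]) &
        forall i, \sum_j w j * phi i (x j) = \int[mu]_x phi i x].
Proof.
move=> muoo iphi.
pose psi x : 'rV[R]_n.+1 := \row_i oapp (phi^~ x) 1 (unlift ord0 i).
have ipsi i : mu.-integrable setT (fun x => (psi x 0 i)%:E).
  case: (unliftP ord0 i) => [j ->|->].
    by apply: eq_integrable (iphi j) => // x _; rewrite mxE liftK.
  apply: eq_integrable (finite_integrable_cst 1 muoo) => // x _.
  by rewrite mxE unlift_none.
have := integral_in_cone_hull measurableT ipsi.
move=> /cone_Caratheodory[w [x [w0 /rowP e]]].
exists x, w; split=> // [|i].
- have := e ord0; rewrite !mxE summxE.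
  under eq_Rintegral do rewrite mxE unlift_none/=.
  rewrite Rintegral_cst// mul1r => ->; apply: eq_bigr => j _.
  by rewrite !mxE unlift_none mulr1.
- have := e (lift ord0 i); rewrite !mxE summxE.
  under eq_Rintegral do rewrite mxE liftK/=.
  by move=> ->; apply: eq_bigr => j _; rewrite !mxE liftK.
Qed.

Lemma bounded_measurable_integrable (d : measure_display) (T : measurableType d)
    (R : realType) (mu : {measure set T -> \bar R}) (f : T -> R) :
  (mu [set: T] < +oo)%E -> bounded_measurable f ->
  mu.-integrable [set: T] (EFin \o f).
Proof. by move=> muoo [mf bf]; exact: measurable_bounded_integrable. Qed.

Lemma Rintegral_lincomb (d : measure_display) (T : measurableType d)
    (R : realType) (mu : {measure set T -> \bar R}) (n : nat)
    (phi : 'I_n -> T -> R) (c : 'I_n -> R) :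
    (forall i, mu.-integrable [set: T] (EFin \o phi i)) ->
  mu.-integrable [set: T] (EFin \o (fun x => \sum_i c i * phi i x)) /\
  \int[mu]_x (\sum_i c i * phi i x) = \sum_i c i * \int[mu]_x phi i x.
Proof.
move=> iphi; pose psi x : 'rV[R]_n := \row_i phi i x.
have ipsi i : mu.-integrable setT (fun x => (psi x 0 i)%:E).
  by apply: eq_integrable (iphi i) => // x _; rewrite mxE.
have dotE x : (psi x *m \col_i c i) 0 0 = \sum_i c i * phi i x.
  by rewrite mxE; apply: eq_bigr => i _; rewrite !mxE mulrC.
split.
  apply: eq_integrable (integrable_dot (\col_i c i) measurableT ipsi) => //.
  by move=> x _; rewrite dotE.
under eq_Rintegral do rewrite -dotE; rewrite Rintegral_dot// mxE.
apply: eq_bigr => i _; rewrite !mxE mulrC.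
by under eq_Rintegral do rewrite mxE.
Qed.

(** The errors at [f] and [f - h] agree by exactness at [h]; the integral and
    the quadrature sum of [f - h] each contribute [mu(Omega) * ||f - h||_oo]. *)
Lemma quadrature_error (d : measure_display) (T : measurableType d)
    (R : realType) (mu : {measure set T -> \bar R}) (m : nat)
    (x : 'I_m -> T) (w : 'I_m -> R) (f h : T -> R) :
    (0 < mu [set: T] < +oo)%E -> (forall j, 0 <= w j) ->
    \sum_j w j = fine (mu [set: T]) ->
    mu.-integrable [set: T] (EFin \o f) ->
    mu.-integrable [set: T] (EFin \o h) ->
    \sum_j w j * h (x j) = \int[mu]_x h x ->
  (`| \int[mu]_x (f x)%:E - (\sum_j w j * f (x j))%R%:E | <=
   (2 * fine (mu [set: T]))%:E * sup_norm (fun x => f x - h x)%R)%E.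
Proof.
move=> /[dup] mu0oo /andP[_ muoo] w0 wsum iF ih exact_h.
set M := fine _; pose g y := f y - h y; rewrite -/g.
have M0 : 0 < M by exact: fine_gt0.
have ig : mu.-integrable setT (EFin \o g).
  exact: (integrableB measurableT iF ih).
rewrite -[X in (`|X - _|)%E]fineK; last exact: integrable_fin_num.
rewrite -EFinB abse_EFin -/(Rintegral mu setT f).
have -> : \int[mu]_y f y - \sum_j w j * f (x j) =
    \int[mu]_y g y - \sum_j w j * g (x j).
  under [X in _ = _ - X]eq_bigr do rewrite mulrBr.
  rewrite RintegralB// sumrB exact_h; ring.
have gs y : (`|g y|%:E <= sup_norm g)%E by apply: ereal_sup_ubound; exists y.
(* An infinite norm makes the bound infinite because mu(Omega) > 0; the value at
   a point rules out the norm -oo. *)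
have := gs point; case: (sup_norm g) gs => [s gs _|_ _|//]; last first.
  by rewrite gt0_muley ?leey// lte_fin mulr_gt0.
have {}gs y : `|g y| <= s by rewrite -lee_fin.
rewrite -EFinM lee_fin (le_trans (ler_normB _ _))// -mulrA.
rewrite -[2]/(1 + 1) mulrDl mul1r lerD//.
  apply: le_trans (le_normr_Rintegral measurableT ig) _.
  rewrite mulrC -(@Rintegral_cst _ _ _ mu _ measurableT s).
  apply: le_Rintegral => //; first exact: integrable_norm.
  exact: finite_integrable_cst.
rewrite /M -wsum mulr_suml (le_trans (ler_norm_sum _ _ _))// ler_sum// => j _.
by rewrite normrM ger0_norm// ler_wpM2l.
Qed.

(** * Comparison of the widths *)

Local Open Scope ereal_scope.

(** One Tchakaloff quadrature for the [phi_i] serves all [f] in [F] and all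
    coefficients at once.  The index [n = 0] is included, which covers the
    separately defined Kolmogorov width of order zero. *)
Lemma tchakaloff_width_le (R : realType) (d : measure_display)
    (T : measurableType d) (mu : {measure set T -> \bar R}) (F : set (T -> R))
    (n : nat) (phi : 'I_n -> T -> R) :
    0 < mu [set: T] < +oo -> F `<=` @bounded_measurable d T R ->
    (forall i, bounded_measurable (phi i)) ->
  tchakaloff_width mu F n.+1 <= (2 * fine (mu [set: T]))%:E *
    ereal_sup [set
      ereal_inf [set
        sup_norm (fun x => f x - \sum_(j < n) c j * phi j x)%R
        | c in [set: 'I_n -> R]]
      | f in F].
Proof.
move=> mu0oo Fbm phibm; have /andP[_ muoo] := mu0oo.
have M2 : (0 < 2 * fine (mu [set: T]))%R by rewrite mulr_gt0// fine_gt0.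
have iphi i : mu.-integrable setT (EFin \o phi i).
  exact: bounded_measurable_integrable.
have [x [w [w0 wsum wphi]]] := Tchakaloff muoo iphi.
apply: le_trans (ereal_inf_lbound _) _; first by exists (x, w).
apply: ge_ereal_sup => _ [f Ff <-] /=; rewrite -lee_pdivrMl//.
apply: le_trans (ereal_sup_ubound _); last by exists f.
apply: le_ereal_inf_tmp => _ [c _ <-]; rewrite lee_pdivrMl//.
have [ih eh] := Rintegral_lincomb c iphi.
apply: quadrature_error => //; first exact/bounded_measurable_integrable/Fbm.
rewrite eh; under eq_bigr do rewrite mulr_sumr.
rewrite exchange_big/=; apply: eq_bigr => i _; rewrite -wphi mulr_sumr.
by apply: eq_bigr => j _; rewrite mulrCA.
Qed.

(** On a null space the quadrature with zero weights is exact. *)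
Lemma tchakaloff_width_null (R : realType) (d : measure_display)
    (T : measurableType d) (mu : {measure set T -> \bar R}) (F : set (T -> R))
    (n : nat) :
  mu [set: T] = 0 -> F `<=` @bounded_measurable d T R ->
  tchakaloff_width mu F n <= 0.
Proof.
move=> mu0 Fbm; apply: le_trans (ereal_inf_lbound _) _.
  by exists (fun=> point, fun=> 0%R).
apply: ge_ereal_sup => _ [f Ff <-] /=.
rewrite big1 => [|j _]; last by rewrite mul0r.
rewrite sube0 null_set_integral ?abse0//.
by have [mf _] := Fbm _ Ff; exact/measurable_EFinP.
Qed.

Theorem theorem4p1 (R : realType) (d : measure_display) (T : measurableType d)
    (mu : {measure set T -> \bar R}) (F : set (T -> R)) :
  mu [set: T] < +oo ->
  F `<=` @bounded_measurable d T R ->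
  forall n : nat,
    tchakaloff_width mu F n.+1 <= 2%:E * mu [set: T] * kolmogorov_width F n.
Proof.
move=> muoo Fbm n.
have [mu0|mu_neq0] := eqVneq (mu [set: T]) 0.
  by rewrite mu0 mule0 mul0e; exact: tchakaloff_width_null.
have mu0oo : 0 < mu [set: T] < +oo.
  by rewrite muoo andbT lt_neqAle eq_sym mu_neq0 measure_ge0.
have M2 : (0 < 2 * fine (mu [set: T]))%R by rewrite mulr_gt0// fine_gt0.
have -> : 2%:E * mu [set: T] = (2 * fine (mu [set: T]))%:E.
  by rewrite EFinM fineK// ge0_fin_numE.
case: n => [|n] /=; last first.
  rewrite -lee_pdivrMl//; apply: le_ereal_inf_tmp => _ [phi phibm <-].
  by rewrite lee_pdivrMl//; exact: tchakaloff_width_le.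
have no_phi (i : 'I_0) : @bounded_measurable d T R (cst 0%R) by case: i.
apply: le_trans (tchakaloff_width_le mu0oo Fbm no_phi) _.
rewrite lee_pmul2l//; apply: ge_ereal_sup => _ [f Ff <-].
apply: le_trans (ereal_sup_ubound _); last by exists f.
apply: ereal_inf_lbound; exists (fun=> 0%R) => //.
by congr sup_norm; apply/funext => x; rewrite big_ord0 subr0.
Qed.
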